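(* Let $q\in\mathbb{C}^\times$ be not a root of unity. Let $V$ be a $\widetilde{V}_{q}$-module in the category $\mathcal{O}$. Then for any nonzero vector $v\in V$, there exists $t\in\mathbb{Z}_{+}$ such that $\widetilde{V}_{q}^{(t)}v=0$.
   Context: All vector spaces are over $\mathbb{C}$, $\mathbb{Z}_{+}$ is the set of positive integers, and $q\in\mathbb{C}^{\times}$ is not a root of unity. The algebra of $q$-difference operators $\widetilde{V}_{q}$: the Lie algebra spanned by $E_{k,l}$ ($(k,l)\in\mathbb{Z}^{2}$), $c_{1}$, $c_{2}$, with the convention $E_{0,0}=0$ (the $E_{k,l}$ with $(k,l)\ne(0,0)$ together with $c_1,c_2$ form a basis), where $c_{1},c_{2}$ are central and $$[E_{k,l},E_{r,s}]=(q^{rl-sk}-q^{sk-rl})E_{k+r,l+s}+\delta_{k,-r}\delta_{l,-s}(kc_{1}+lc_{2}).$$ For $t\in\mathbb{Z}_{+}$ let $\widetilde{V}_{q}^{(t)}=\sum_{k\in\mathbb{Z},\,l\geq t}\mathbb{C}E_{k,l}$, a subalgebra of $\widetilde{V}_{q}$. A module $V$ over a Lie algebra $L$ is locally finite if $\dim\big(\sum_{n\in\mathbb{Z}_{+}}L^{n}v\big)<+\infty$ for every $v\in V$. The category $\mathcal{O}$ consists of the $\widetilde{V}_{q}$-modules that are locally finite with respect to $\widetilde{V}_{q}^{(t)}$ for some $t\in\mathbb{Z}_{+}$. *)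

(* Defs.v *)
From HB Require Import structures.
From mathcomp Require Import all_boot all_order all_algebra.
From mathcomp Require Import classical_sets reals.
From mathcomp Require Import complex finmap monalg.
From mathcomp Require Import ring zify.

Set Implicit Arguments.
Unset Strict Implicit.
Unset Printing Implicit Defensive.

Import GRing.Theory.

Local Open Scope classical_set_scope.
Local Open Scope ring_scope.

HB.mixin Record Lmodule_isLieAlgebra (K : fieldType) L of GRing.Lmodule K L := {
  lieb : L -> L -> L;
  lieb_linearl : forall y, linear (fun x => lieb x y);
  lieb_linearr : forall x, linear (lieb x);
  liebb : forall x, lieb x x = 0;
  lieb_jacobi : forall x y z,
    lieb x (lieb y z) + lieb y (lieb z x) + lieb z (lieb x y) = 0
}.

#[short(type="lieAlgType")]
HB.structure Definition LieAlgebra (K : fieldType) :=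
  {L of GRing.Lmodule K L & Lmodule_isLieAlgebra K L}.

HB.mixin Record Lmodule_isLieModule (K : fieldType) (L : lieAlgType K) V
    of GRing.Lmodule K V := {
  lact : L -> V -> V;
  lact_linearl : forall v, linear (fun x => lact x v);
  lact_linearr : forall x, linear (lact x);
  lact_lieb : forall x y v,
    lact (lieb x y) v = lact x (lact y v) - lact y (lact x v)
}.

#[short(type="lieModType")]
HB.structure Definition LieModule (K : fieldType) (L : lieAlgType K) :=
  {V of GRing.Lmodule K V & Lmodule_isLieModule K L V}.

Section Span.
Variables (K : fieldType) (V : lmodType K).

Definition lspan (A : set V) : set V :=
  [set w | exists2 s : seq (K * V), (forall p, p \in s -> A p.2) &
                                    w = \sum_(p <- s) p.1 *: p.2].

Definition fin_dim (W : set V) : Prop := exists s : seq V, W = lspan [set` s].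

End Span.

Section LocallyFinite.
Variables (K : fieldType) (L : lieAlgType K) (V : lieModType L).

(* S^n v, the span of the x_1 (x_2 ( ... (x_n v))) with all x_i in S; the
   value at n = 0 only serves to start the iteration. *)
Definition lie_power (S : set L) (n : nat) (v : V) : set V :=
  iter n (fun W => lspan [set lact x w | x in S & w in W]) [set v].

(* Stated for a subset S of L, so that a subalgebra S acts by restriction. *)
Definition locally_finite (S : set L) : Prop :=
  forall v : V, fin_dim (lspan (\bigcup_(n in [set n | (0 < n)%N])
                                  lie_power S n v)).

End LocallyFinite.

(* The basis of the algebra: the (k, l) != (0, 0) stand for E_{k,l}, and
   false, true for the central elements c_1, c_2. *)
Definition qdiff_index : choiceType := ({kl : int * int | kl != 0} + bool)%type.

Definition qdiff (K : fieldType) (q : K) : Type := {malg K[qdiff_index]}.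
HB.instance Definition _ (K : fieldType) (q : K) :=
  GRing.Lmodule.copy (qdiff q) {malg K[qdiff_index]}.

Section QDifference.
Variables (K : fieldType) (q : K).
Local Notation Vq := (qdiff q).

Definition qdE (k l : int) : Vq :=
  if insub (k, l) is Some i then << inl i : qdiff_index >> else 0.
Definition qdc1 : Vq := << inr false : qdiff_index >>.
Definition qdc2 : Vq := << inr true : qdiff_index >>.

Definition qd_coef (k l r s : int) : K :=
  q ^ (r * l - s * k) - q ^ (s * k - r * l).

Definition qd_bracketE (k l r s : int) : Vq :=
  qd_coef k l r s *: qdE (k + r) (l + s)
  + ((k == - r) && (l == - s))%:R *: (k%:~R *: qdc1 + l%:~R *: qdc2).

Definition qd_bracket_basis (i j : qdiff_index) : Vq :=
  match i, j with
  | inl a, inl b => qd_bracketE (val a).1 (val a).2 (val b).1 (val b).2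
  | _, _ => 0
  end.

Definition qd_bracket (x y : Vq) : Vq :=
  \sum_(i <- msupp (x : {malg K[qdiff_index]}))
    \sum_(j <- msupp (y : {malg K[qdiff_index]}))
       (mcoeff i x * mcoeff j y) *: qd_bracket_basis i j.

Lemma qd_bracketEw (d1 d2 : {fset qdiff_index}) (x y : Vq) :
  (msupp (x : {malg K[qdiff_index]}) `<=` d1)%fset ->
  (msupp (y : {malg K[qdiff_index]}) `<=` d2)%fset ->
  qd_bracket x y = \sum_(i <- d1) \sum_(j <- d2)
       (mcoeff i x * mcoeff j y) *: qd_bracket_basis i j.
Proof.
move=> h1 h2; rewrite /qd_bracket.
rewrite (big_fset_incl _ h1) /=; last first.
  move=> i _ /mcoeff_outdom xi; rewrite big1 // => j _.
  by rewrite xi mul0r scale0r.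
apply: eq_bigr => i _.
rewrite (big_fset_incl _ h2) //= => j _ /mcoeff_outdom yj.
by rewrite yj mulr0 scale0r.
Qed.

Lemma qd_bracket_linearl y : linear (fun x => qd_bracket x y).
Proof.
move=> a x1 x2 /=.
pose m (x : Vq) := msupp (x : {malg K[qdiff_index]}).
pose d := (m (a *: x1 + x2)%R `|` m x1 `|` m x2)%fset.
rewrite !(@qd_bracketEw d (m y)) ?fsubset_refl ?fsubsetUr //.
- rewrite scaler_sumr -big_split /=; apply: eq_bigr => i _.
  rewrite scaler_sumr -big_split /=; apply: eq_bigr => j _.
  rewrite scalerA -scalerDl; congr (_ *: _).
  by rewrite mcoeffD mcoeffZ mulrDl mulrA.
- by rewrite /d fsetUAC fsubsetUr.
- by rewrite /d -fsetUA fsubsetUl.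
Qed.

Lemma qd_bracket_linearr x : linear (qd_bracket x).
Proof.
move=> a y1 y2 /=.
pose m (x : Vq) := msupp (x : {malg K[qdiff_index]}).
pose d := (m (a *: y1 + y2)%R `|` m y1 `|` m y2)%fset.
rewrite !(@qd_bracketEw (m x) d) ?fsubset_refl ?fsubsetUr //.
- rewrite scaler_sumr -big_split /=; apply: eq_bigr => i _.
  rewrite scaler_sumr -big_split /=; apply: eq_bigr => j _.
  rewrite scalerA -scalerDl; congr (_ *: _).
  by rewrite mcoeffD mcoeffZ mulrDr !mulrA (mulrC a).
- by rewrite /d fsetUAC fsubsetUr.
- by rewrite /d -fsetUA fsubsetUl.
Qed.

Lemma qd_bracket0l y : qd_bracket 0 y = 0.
Proof.
have := qd_bracket_linearl y (-1) 0 0.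
by rewrite scaler0 addr0 scaleN1r addNr.
Qed.

Lemma qd_bracket0r x : qd_bracket x 0 = 0.
Proof.
have := qd_bracket_linearr x (-1) 0 0.
by rewrite scaler0 addr0 scaleN1r addNr.
Qed.

Lemma qd_bracketPl a x1 x2 y :
  qd_bracket (a *: x1 + x2) y = a *: qd_bracket x1 y + qd_bracket x2 y.
Proof. exact: qd_bracket_linearl. Qed.

Lemma qd_bracketPr a x y1 y2 :
  qd_bracket x (a *: y1 + y2) = a *: qd_bracket x y1 + qd_bracket x y2.
Proof. exact: qd_bracket_linearr. Qed.

Lemma qd_bracketZr x a y : qd_bracket x (a *: y) = a *: qd_bracket x y.
Proof. by rewrite -[a *: y]addr0 qd_bracket_linearr qd_bracket0r addr0. Qed.

Lemma qd_bracketUU (i j : qdiff_index) :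
  qd_bracket (<< i >> : {malg K[qdiff_index]}) (<< j >> : {malg K[qdiff_index]})
  = qd_bracket_basis i j.
Proof.
rewrite (@qd_bracketEw [fset i]%fset [fset j]%fset) ?msuppU_le //.
by rewrite !big_seq_fset1 !mcoeffUU mulr1 scale1r.
Qed.

Lemma qdE00 : qdE 0 0 = 0.
Proof. by rewrite /qdE insubF. Qed.

Lemma qdEval (a : {kl : int * int | kl != 0}) :
  << inl a : qdiff_index >> = qdE (val a).1 (val a).2.
Proof. by rewrite /qdE -surjective_pairing valK. Qed.

Lemma qdEP k l : (k = 0 /\ l = 0) \/
  exists a : {kl : int * int | kl != 0}, val a = (k, l)
                                         /\ qdE k l = << inl a : qdiff_index >>.
Proof.
rewrite /qdE; case: insubP => [a _ <-|]; first by right; exists a.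
by rewrite negbK => /eqP[-> ->]; left.
Qed.

Lemma qd_coefE0 k l : qd_coef k l 0 0 = 0.
Proof. by rewrite /qd_coef !mul0r subrr. Qed.

Lemma qd_coef0E k l : qd_coef 0 0 k l = 0.
Proof. by rewrite /qd_coef !mulr0 subrr. Qed.

Lemma qd_bracketEE k l r s : qd_bracket (qdE k l) (qdE r s) =
  (q ^ (r * l - s * k) - q ^ (s * k - r * l)) *: qdE (k + r) (l + s)
  + ((k == - r) && (l == - s))%:R *: (k%:~R *: qdc1 + l%:~R *: qdc2).
Proof.
rewrite -/(qd_coef k l r s).
case: (qdEP k l) => [[-> ->]|[a [va ->]]].
  rewrite qdE00 qd_bracket0l qd_coef0E scale0r add0r.
  by rewrite !scale0r addr0 scaler0.
case: (qdEP r s) => [[-> ->]|[b [vb ->]]].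
  rewrite qdE00 qd_bracket0r qd_coefE0 scale0r add0r !oppr0.
  by case: eqP => [->|]; case: eqP => [->|]; rewrite ?scale0r ?addr0 ?scaler0.
by rewrite qd_bracketUU /= va vb.
Qed.

Lemma qd_bracket_centrall (b : bool) x :
  qd_bracket (<< inr b : qdiff_index >> : {malg K[qdiff_index]}) x = 0.
Proof.
rewrite /qd_bracket big_seq big1 // => i ii; rewrite big1 // => j _.
have /fsubsetP/(_ i ii) := @msuppU_le _ K (inr b : qdiff_index) 1.
by rewrite in_fset1 => /eqP ->; rewrite scaler0.
Qed.

Lemma qd_bracket_centralr (b : bool) x :
  qd_bracket x (<< inr b : qdiff_index >> : {malg K[qdiff_index]}) = 0.
Proof.
rewrite /qd_bracket big1 // => i _; rewrite big_seq big1 // => j jj.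
have /fsubsetP/(_ j jj) := @msuppU_le _ K (inr b : qdiff_index) 1.
by rewrite in_fset1 => /eqP ->; case: i => ?; rewrite scaler0.
Qed.

Lemma qd_bracket_c1l x : qd_bracket qdc1 x = 0.
Proof. exact: qd_bracket_centrall. Qed.

Lemma qd_bracket_c2l x : qd_bracket qdc2 x = 0.
Proof. exact: qd_bracket_centrall. Qed.

Lemma qd_bracket_c1r x : qd_bracket x qdc1 = 0.
Proof. exact: qd_bracket_centralr. Qed.

Lemma qd_bracket_c2r x : qd_bracket x qdc2 = 0.
Proof. exact: qd_bracket_centralr. Qed.

Definition qd_bracket_central :=
  (qd_bracket_c1l, qd_bracket_c2l, qd_bracket_c1r, qd_bracket_c2r).

Lemma qd_ind (P : Vq -> Prop) :
  (forall a x y, P x -> P y -> P (a *: x + y)) ->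
  (forall k l, P (qdE k l)) -> P qdc1 -> P qdc2 -> forall x, P x.
Proof.
move=> PD PE P1 P2 x.
have P0 : P 0 by rewrite -qdE00.
suff PS (s : seq qdiff_index) :
    P (\sum_(i <- s) << mcoeff i x *g i >> : {malg K[qdiff_index]}).
  by have := PS (msupp (x : {malg K[qdiff_index]})); rewrite -monalgE.
elim: s => [|i s IHs]; first by rewrite big_nil.
rewrite big_cons.
have -> : << mcoeff i x *g i >> = mcoeff i x *: << i >> :> {malg K[qdiff_index]}.
  by apply/malgP => j; rewrite mcoeffZ !mcoeffU mulrnAr mulr1.
apply: PD IHs; case: i => [a|[]] //.
by rewrite qdEval.
Qed.

Lemma qd_coefN k l r s : qd_coef k l r s = - qd_coef r s k l.
Proof.
rewrite /qd_coef opprB; congr (q ^ _ - q ^ _); ring.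
Qed.


Lemma qd_bracketC x y : qd_bracket x y = - qd_bracket y x.
Proof.
move: x; apply: qd_ind => [a x x' IHx IHx'|k l||].
- by rewrite qd_bracket_linearl qd_bracket_linearr IHx IHx' scalerN -opprD.
- move: y; apply: qd_ind => [a y y' IHy IHy'|r s||].
  + by rewrite qd_bracket_linearl qd_bracket_linearr IHy IHy' scalerN -opprD.
  + rewrite !qd_bracketEE -!/(qd_coef _ _ _ _) (qd_coefN r s).
    rewrite (addrC r) (addrC s) scaleNr opprD opprK; congr (_ + _).
    rewrite (eq_sym r) (eq_sym s) !eqr_oppLR.
    case: eqP => [->|_] /=; last by rewrite !scale0r oppr0.
    case: eqP => [->|_] /=; last by rewrite !scale0r oppr0.
    by rewrite !scale1r !mulrNz !scaleNr -opprD.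
  + by rewrite !qd_bracket_central oppr0.
  + by rewrite !qd_bracket_central oppr0.
- by rewrite !qd_bracket_central oppr0.
- by rewrite !qd_bracket_central oppr0.
Qed.

Lemma qd_bracketxx x : qd_bracket x x = 0.
Proof.
move: x; apply: qd_ind => [a x y IHx IHy|k l||]; rewrite ?qd_bracket_central //.
  rewrite qd_bracket_linearl !qd_bracket_linearr IHx IHy (qd_bracketC y x).
  by rewrite scaler0 add0r addr0 scalerN subrr.
rewrite qd_bracketEE (mulrC l) !subrr scale0r add0r.
rewrite (eq_sym k) (eq_sym l) !Num.Theory.eqNr.
case: eqP => [->|_] /=; last by rewrite scale0r.
case: eqP => [->|_] /=; last by rewrite scale0r.
by rewrite !scale0r addr0 scaler0.
Qed.

Definition qd_f (n : int) : K := q ^ n - q ^ (- n).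
Local Notation f := qd_f.

Lemma qd_coef_jacobi (a b c : int) :
  f b * f (a - c) + f c * f (b - a) + f a * f (c - b) = 0.
Proof.
case: (eqVneq q 0) => [q0|q0].
  have f0 n : f n = 0 by rewrite /f q0 !exp0rz oppr_eq0 subrr.
  by rewrite !f0 !mul0r !addr0.
rewrite /f !opprB !expfzDr // -!invr_expz.
ring.
Qed.

#[local] Opaque qd_bracket qdE qdc1 qdc2.

Lemma qd_bracketEEE (k l r s u v : int) :
  qd_bracket (qdE k l) (qd_bracket (qdE r s) (qdE u v)) =
    f (u * s - v * r) *:
      (f ((r + u) * l - (s + v) * k) *: qdE (k + r + u) (l + s + v)
      + ((k + r + u == 0) && (l + s + v == 0))%:R
        *: (k%:~R *: qdc1 + l%:~R *: qdc2)).
Proof.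
rewrite (qd_bracketEE r s u v) qd_bracketPr qd_bracketZr qd_bracketPr.
rewrite qd_bracketZr qd_bracket_c1r qd_bracket_c2r !scaler0 addr0 scaler0 addr0.
by rewrite qd_bracketEE /f !opprB !addrA -!addr_eq0 !addrA.
Qed.

Lemma qd_jacobi x y z :
  qd_bracket x (qd_bracket y z) + qd_bracket y (qd_bracket z x)
  + qd_bracket z (qd_bracket x y) = 0.
Proof.
pose J x y z := qd_bracket x (qd_bracket y z) + qd_bracket y (qd_bracket z x)
                + qd_bracket z (qd_bracket x y).
have comb a (u u' v v' w w' : Vq) : u + v + w = 0 -> u' + v' + w' = 0 ->
    (a *: u + u') + (a *: v + v') + (a *: w + w') = 0.
  move=> h h'; rewrite (addrACA (a *: u) _ (a *: v)) -scalerDr addrACA -scalerDr h h'.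
  by rewrite scaler0 addr0.
have JD a x1 x2 y1 z1 : J x1 y1 z1 = 0 -> J x2 y1 z1 = 0 ->
    J (a *: x1 + x2) y1 z1 = 0.
  move=> h1 h2; rewrite /J (qd_bracketPl a x1 x2) (qd_bracketPr a z1 x1).
  rewrite (qd_bracketPl a x1 x2 y1) (qd_bracketPr a y1) (qd_bracketPr a z1).
  exact: (comb _ _ _ _ _ _ _ h1 h2).
have JC x1 y1 z1 : J x1 y1 z1 = J y1 z1 x1.
  exact: (etrans (esym (addrA _ _ _)) (addrC _ _)).
have J1 y1 z1 : J qdc1 y1 z1 = 0.
  rewrite /J qd_bracket_c1l (qd_bracket_c1r z1) (qd_bracket_c1l y1).
  by rewrite !qd_bracket0r !addr0.
have J2 y1 z1 : J qdc2 y1 z1 = 0.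
  rewrite /J qd_bracket_c2l (qd_bracket_c2r z1) (qd_bracket_c2l y1).
  by rewrite !qd_bracket0r !addr0.
rewrite -/(J x y z).
move: x; apply: qd_ind => [a x x' IHx IHx'|k l||]; [exact: JD| |exact: J1|exact: J2].
rewrite JC.
move: y; apply: qd_ind => [a y y' IHy IHy'|r s||]; [exact: JD| |exact: J1|exact: J2].
rewrite JC.
move: z; apply: qd_ind => [a z z' IHz IHz'|u v||]; [exact: JD| |exact: J1|exact: J2].
rewrite JC /J.
rewrite !qd_bracketEEE.
have -> : r + u + k = k + r + u by ring.
have -> : s + v + l = l + s + v by ring.
have -> : u + k + r = k + r + u by ring.
have -> : v + l + s = l + s + v by ring.
set e := qdE _ _; set d := (_ && _).
pose A := r * l - s * k; pose B := u * s - v * r; pose C := k * v - l * u.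
rewrite -/B -/C -/A.
have -> : (r + u) * l - (s + v) * k = A - C by rewrite /A /C; ring.
have -> : (u + k) * s - (v + l) * r = B - A by rewrite /A /B; ring.
have -> : (k + r) * v - (l + s) * u = C - B by rewrite /B /C; ring.
have [H1 H2] : d%:R * (f B * k%:~R + f C * r%:~R + f A * u%:~R) = 0 :> K /\
               d%:R * (f B * l%:~R + f C * s%:~R + f A * v%:~R) = 0 :> K.
  rewrite /d; case: eqP => [|_] /=; last by rewrite !mul0r.
  move=> /eqP; rewrite addrC addr_eq0 => /eqP uE.
  case: eqP => [|_] /=; last by rewrite !mul0r.
  move=> /eqP; rewrite addrC addr_eq0 => /eqP vE.
  have -> : B = A by rewrite /B /A uE vE; ring.
  have -> : C = A by rewrite /C /A uE vE; ring.
  by rewrite uE vE !mulrNz !intrD; split; ring.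
have lin3 (W : lmodType K) (e' c1 c2 : W) (p1 p2 p3 g1 g2 g3 : K) (d' : K)
    (k1 k2 k3 l1 l2 l3 : K) :
    p1 *: (g1 *: e' + d' *: (k1 *: c1 + l1 *: c2))
    + p2 *: (g2 *: e' + d' *: (k2 *: c1 + l2 *: c2))
    + p3 *: (g3 *: e' + d' *: (k3 *: c1 + l3 *: c2))
    = (p1 * g1 + p2 * g2 + p3 * g3) *: e'
      + ((d' * (p1 * k1 + p2 * k2 + p3 * k3)) *: c1
         + (d' * (p1 * l1 + p2 * l2 + p3 * l3)) *: c2).
  rewrite !mulrDr !scalerDl !scalerDr !scalerA !(mulrCA d') -!mulrA.
  have ac (x1 y1 z1 x2 y2 z2 : W) : x1 + (y1 + z1) + (x2 + (y2 + z2))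
      = (x1 + x2) + ((y1 + y2) + (z1 + z2)) by rewrite addrACA (addrACA y1).
  exact: etrans (congr1 ( +%R^~ _) (ac _ _ _ _ _ _)) (ac _ _ _ _ _ _).
by rewrite lin3 qd_coef_jacobi H1 H2 !scale0r !addr0.
Qed.

End QDifference.

HB.instance Definition _ (K : fieldType) (q : K) :=
  Lmodule_isLieAlgebra.Build K (qdiff q) (@qd_bracket_linearl K q)
    (@qd_bracket_linearr K q) (@qd_bracketxx K q) (@qd_jacobi K q).

Section Presentation.
Variables (K : fieldType) (q : K).

Lemma lieb_qdEE (k l r s : int) : lieb (qdE q k l) (qdE q r s) =
  (q ^ (r * l - s * k) - q ^ (s * k - r * l)) *: qdE q (k + r) (l + s)
  + ((k == - r) && (l == - s))%:R *: (k%:~R *: qdc1 q + l%:~R *: qdc2 q).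
Proof. exact: qd_bracketEE. Qed.

Lemma lieb_qdc1 (x : qdiff q) : lieb (qdc1 q) x = 0.
Proof. exact: qd_bracket_centrall. Qed.

Lemma lieb_qdc2 (x : qdiff q) : lieb (qdc2 q) x = 0.
Proof. exact: qd_bracket_centrall. Qed.

End Presentation.

Section CategoryO.
Variables (K : fieldType) (q : K).

Definition qdiff_ge (t : nat) : set (qdiff q) :=
  lspan [set qdE q k l | k in [set: int] & l in [set l : int | t%:Z <= l]].

Lemma qdiff_ge_lieb (t : nat) x y : (0 < t)%N ->
  qdiff_ge t x -> qdiff_ge t y -> qdiff_ge t (lieb x y).
Proof.
move=> t0.
have lin0l z : lieb 0 z = 0 :> qdiff q by exact: qd_bracket0l.
have lin0r z : lieb z 0 = 0 :> qdiff q by exact: qd_bracket0r.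
have comb a u v : qdiff_ge t u -> qdiff_ge t v -> qdiff_ge t (a *: u + v).
  move=> [s1 h1 ->] [s2 h2 ->]; exists ([seq (a * p.1, p.2) | p <- s1] ++ s2).
    by move=> p; rewrite mem_cat => /orP[/mapP[p' /h1 ? ->]|/h2].
  rewrite big_cat big_map scaler_sumr; congr (_ + _).
  by apply: eq_bigr => p _; rewrite scalerA.
have g0 : qdiff_ge t 0 by exists [::]; rewrite ?big_nil.
case=> s1 + ->; elim: s1 => [|p1 s1 IH1] h1 hy; first by rewrite big_nil lin0l.
rewrite big_cons lieb_linearl; apply: (comb); last first.
  by apply: IH1 => // p ps; apply: h1; rewrite in_cons ps orbT.
have /= := h1 p1 (mem_head _ _); case: p1 {h1} => a1 e1 /= [k _ [l tl <-]].
case: hy => s2 + ->; elim: s2 => [|p2 s2 IH2] h2; first by rewrite big_nil lin0r.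
rewrite big_cons lieb_linearr; apply: (comb); last first.
  by apply: IH2 => p ps; apply: h2; rewrite in_cons ps orbT.
have /= := h2 p2 (mem_head _ _); case: p2 {h2} => a2 e2 /= [r _ [s ts <-]].
rewrite lieb_qdEE; have -> : (l == - s) = false by move: tl ts => /=; lia.
rewrite andbF scale0r; apply: (comb) => //.
exists [:: (1, qdE q (k + r) (l + s))]; last by rewrite big_seq1 scale1r.
move=> p; rewrite inE => /eqP -> /=; exists (k + r) => //; exists (l + s) => //=.
by move: tl ts => /=; lia.
Qed.

Definition categoryO (V : lieModType (qdiff q)) : Prop :=
  exists2 t : nat, (0 < t)%N & locally_finite V (qdiff_ge t).

End CategoryO.
Arguments qdiff_ge {K} q t.

(* Main.v *)
Require Import Defs.
From mathcomp Require Import all_boot all_order all_algebra.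
From mathcomp Require Import classical_sets reals.
From mathcomp Require Import complex finmap monalg.
From mathcomp Require Import boolp ring zify.

Local Open Scope ring_scope.

(** Let [L] be the span of the E_{k,l} with [l >= t], where [t] is given by
    the category O.  The vector [v] together with the spaces [L^n v] spans a
    finite-dimensional [L]-stable space [M], so the ideal [I] of those elements
    of [L] that kill [M] has finite codimension, and it is enough to find a
    whole tail of rows of the lattice inside [I].

    - The infinitely many operators E_{k,t}, [k >= 0], act on the
      finite-dimensional [M], so some nontrivial combination of them lies in
      [I] ([stable_operators_dependent]).
    - Bracketing an element of row [l] with E_{k t, l t} multiplies
      its E_{k',l}-term by q^n - q^(-n), where n = l t (k' - k), and moves it
      to E_{k'+k t,l+l t}.  As [q] is not a root of unity, this kills exactly the term [k' = k], so any nonzero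
      combination in [I] can be shortened until a single E_{k,l} is left
      ([annihilator_has_monomial]).
    - If E_{k,l} is in [I], bracketing with E_{m-k,n-l} puts into [I] every
      E_{m,n} with [n >= l + t] that is not on the line through the
      origin and [(k, l)] ([annihilator_off_line]).  One such E_{m,n} gives a
      second line; the two lines meet only at the origin, hence together they
      yield every row [n] that is high enough ([annihilator_tail]). *)

(** * Spans *)

Section Span.
Set Implicit Arguments.
Unset Strict Implicit.
Local Open Scope classical_set_scope.
Import GRing.Theory.
Variables (K : fieldType) (V : lmodType K).
Implicit Types (A P : set V) (s : seq V).

Lemma sub_lspan A : A `<=` lspan A.
Proof.
move=> w Aw; exists [:: (1, w)]; last by rewrite big_seq1 scale1r.
by move=> p; rewrite inE => /eqP ->.
Qed.

Lemma lspan_min A P : P 0 -> (forall a u w, P u -> P w -> P (a *: u + w)) ->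
  A `<=` P -> lspan A `<=` P.
Proof.
move=> P0 PD AP _ [s + ->]; elim: s => [|p s IHs] sA; first by rewrite big_nil.
rewrite big_cons; apply: PD; first by apply/AP/sA/mem_head.
by apply: IHs => p' p's; apply: sA; rewrite in_cons p's orbT.
Qed.

Lemma lspan0 A : lspan A 0.
Proof. by exists [::]; rewrite ?big_nil. Qed.

Lemma lspanP A a u w : lspan A u -> lspan A w -> lspan A (a *: u + w).
Proof.
move=> [s1 h1 ->] [s2 h2 ->]; exists ([seq (a * p.1, p.2) | p <- s1] ++ s2).
  by move=> p; rewrite mem_cat => /orP[/mapP[p' /h1 ? ->]|/h2].
rewrite big_cat big_map scaler_sumr; congr (_ + _).
by apply: eq_bigr => p _; rewrite scalerA.
Qed.

Lemma lspanS A B : A `<=` lspan B -> lspan A `<=` lspan B.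
Proof. by apply: lspan_min; [exact: lspan0 | exact: lspanP]. Qed.

Lemma lspan_seqP s w : lspan [set` s] w ->
  exists c : 'rV[K]_(size s), w = \sum_(i < size s) c 0 i *: s`_i.
Proof.
move: w; apply: lspan_min => [|a u w [c ->] [d ->]|w /= ws].
- by exists 0; rewrite big1 // => i _; rewrite mxE scale0r.
- exists (a *: c + d); rewrite scaler_sumr -big_split /=.
  by apply: eq_bigr => i _; rewrite !mxE scalerDl scalerA.
- have wi : (index w s < size s)%N by rewrite index_mem.
  exists (delta_mx 0 (Ordinal wi)); rewrite (bigD1 (Ordinal wi)) //= big1.
    by rewrite mxE !eqxx scale1r nth_index // addr0.
  by move=> i /negPf ni; rewrite mxE eqxx /= ni scale0r.
Qed.

(** The spanning family [s] may be dependent, so the operators have no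
    well-defined matrices; choosing any matrices that express their values on
    [s] is enough, since a linear relation between the matrices passes to the
    operators.  More than [(size s)^2] matrices of order [size s] satisfy a
    nontrivial linear relation. *)
Lemma stable_operators_dependent s (T : nat -> V -> V) :
  (forall k, linear (T k)) ->
  (forall k u, u \in s -> lspan [set` s] (T k u)) ->
  exists N (a : 'I_N -> K), (exists i, a i != 0) /\
    forall w, lspan [set` s] w -> \sum_(i < N) a i *: T i w = 0.
Proof.
move=> Tlin Ts; set m := size s; set N := (m * m).+1.
have /choice[A AE] : forall k, exists A : 'M[K]_m,
    forall j : 'I_m, T k s`_j = \sum_(i < m) A j i *: s`_i.
  move=> k; have /choice[c cE] : forall j : 'I_m, exists c : 'rV[K]_m,
      T k s`_j = \sum_(i < m) c 0 i *: s`_i.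
    by move=> j; apply/lspan_seqP/Ts/mem_nth.
  by exists (\matrix_(j, i) c j 0 i) => j; rewrite cE; apply: eq_bigr => i _; rewrite mxE.
pose B : 'M[K]_(N, m * m) := \matrix_(k < N) mxvec (A k).
have /rowV0Pn[a /sub_kermxP aB a0] : kermx B != 0.
  by rewrite -mxrank_eq0 mxrank_ker -lt0n subn_gt0 ltnS rank_leq_col.
exists N, (fun i => a 0 i); split.
  by move/rV0Pn: a0.
have sumA i j : \sum_(k < N) a 0 k * A k j i = 0.
  move/rowP/(_ (mxvec_index j i)): aB; rewrite !mxE; apply: etrans.
  by apply: eq_bigr => k _; rewrite mxE mxvecE.
apply: lspan_min => [|b u w hu hw|w /= ws].
- rewrite big1 // => i _; have := Tlin i (-1) 0 0.
  by rewrite scaler0 addr0 scaleN1r addNr => ->; rewrite scaler0.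
- have -> : \sum_(i < N) a 0 i *: T i (b *: u + w) =
      b *: (\sum_(i < N) a 0 i *: T i u) + \sum_(i < N) a 0 i *: T i w.
    rewrite scaler_sumr -big_split /=.
    by apply: eq_bigr => i _; rewrite Tlin scalerDr !scalerA mulrC.
  by rewrite hu hw scaler0 addr0.
- have wi : (index w s < m)%N by rewrite index_mem.
  rewrite -(nth_index 0 ws).
  have TE (k : 'I_N) : a 0 k *: T k s`_(index w s) =
      \sum_(i < m) (a 0 k * A k (Ordinal wi) i) *: s`_i.
    rewrite (AE k (Ordinal wi)) scaler_sumr.
    by apply: eq_bigr => i _; rewrite scalerA.
  rewrite (eq_bigr _ (fun k _ => TE k)) exchange_big big1 //= => i _.
  by rewrite -scaler_suml sumA scale0r.
Qed.

End Span.

(** * Lie modules *)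

Section LieModule.
Set Implicit Arguments.
Unset Strict Implicit.
Local Open Scope classical_set_scope.
Import GRing.Theory.
Variables (K : fieldType) (L : lieAlgType K) (V : lieModType L).
Implicit Types (x y : L) (v w : V) (S : set L) (M : set V).

Lemma lact0l v : lact (0 : L) v = 0.
Proof.
have := lact_linearl v (-1) (0 : L) 0.
by rewrite scaler0 addr0 => ->; rewrite scaleN1r addNr.
Qed.

Lemma lact0r x : lact x (0 : V) = 0.
Proof.
have := lact_linearr x (-1) (0 : V) 0.
by rewrite scaler0 addr0 => ->; rewrite scaleN1r addNr.
Qed.

Lemma lactZl a x v : lact (a *: x) v = a *: lact x v.
Proof. by rewrite -[a *: x]addr0 (lact_linearl v) lact0l addr0. Qed.

Lemma lact_suml (I : Type) (r : seq I) (a : I -> K) (F : I -> L) v :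
  lact (\sum_(i <- r) a i *: F i) v = \sum_(i <- r) a i *: lact (F i) v.
Proof.
elim: r => [|i r IHr]; first by rewrite !big_nil lact0l.
by rewrite !big_cons (lact_linearl v) IHr.
Qed.

Definition annihilates x M := forall w, M w -> lact x w = 0.

Lemma annihilates_lieb M x y :
  (forall w, M w -> M (lact y w)) -> annihilates x M ->
  annihilates (lieb y x) M.
Proof.
by move=> yM xM w Mw; rewrite lact_lieb !xM ?lact0r ?subr0 //; apply: yM.
Qed.

Lemma annihilatesZ M a x :
  a != 0 -> annihilates (a *: x) M -> annihilates x M.
Proof.
move=> a0 axM w Mw; have /eqP := axM w Mw.
by rewrite lactZl scaler_eq0 (negPf a0) => /eqP.
Qed.

(** The iterated spaces [S^n v] start at [n = 1], so their sum is stable but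
    need not contain [v]; adjoining [v] keeps it stable, because [S v] is the
    case [n = 1]. *)
Lemma locally_finite_stable S v : locally_finite V S ->
  exists2 s : seq V, v \in s &
    forall x w, S x -> lspan [set` s] w -> lspan [set` s] (lact x w).
Proof.
move=> /(_ v)[s sE]; exists (v :: s); first exact: mem_head.
have sub_vs : lspan [set` s] `<=` lspan [set` v :: s].
  by apply: lspanS => u /= us; apply: sub_lspan; rewrite /= in_cons us orbT.
move=> x w Sx; move: w.
have next n w : lie_power S n v w -> lspan [set` s] (lact x w).
  move=> nw; rewrite -sE; apply: sub_lspan; exists n.+1 => //=.
  by apply: sub_lspan; exists x => //; exists w.
apply: lspan_min => [|a u w hu hw|w /=].
- by rewrite lact0r; apply: lspan0.
- by rewrite lact_linearr; apply: lspanP.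
rewrite in_cons => /predU1P[->|ws]; apply: sub_vs; first exact: (next 0%N).
have : lspan [set` s] w by apply: sub_lspan.
rewrite -{1}sE; move: w {ws}; apply: lspan_min => [|a u w hu hw|w [n _]].
- by rewrite lact0r; apply: lspan0.
- by rewrite lact_linearr; apply: lspanP.
- exact: next.
Qed.

End LieModule.

(** * Annihilators in the algebra of q-difference operators *)

Section Annihilator.
Set Implicit Arguments.
Unset Strict Implicit.
Local Open Scope classical_set_scope.
Import GRing.Theory.
Variables (K : fieldType) (q : K) (V : lieModType (qdiff q)).
Hypothesis q_neq0 : q != 0.
Hypothesis q_not_root : forall n : nat, (0 < n)%N -> ~~ n.-unity_root q.

Lemma exprz_subN_neq0 (n : int) : n != 0 -> q ^ n - q ^ (- n) != 0.
Proof.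
have pos (m : nat) : (0 < m)%N -> q ^ m%:Z - q ^ (- m%:Z) != 0.
  move=> m0; apply: contra (q_not_root (_ : (0 < m + m)%N)); last by lia.
  move/eqP/subr0_eq => h; apply/unity_rootP.
  by rewrite -/(q ^ (m + m)%N%:Z) PoszD expfzDr // {1}h -expfzDr // addNr expr0z.
case: n => m m0; first by apply: pos; lia.
by rewrite NegzE opprK -opprB oppr_eq0; apply: pos.
Qed.

Lemma lieb_qdE_pos (k l r s : int) : 0 < l -> 0 < s ->
  lieb (qdE q k l) (qdE q r s) = qd_coef q k l r s *: qdE q (k + r) (l + s).
Proof.
move=> l0 s0; rewrite lieb_qdEE; have -> : (l == - s) = false by lia.
by rewrite andbF scale0r addr0.
Qed.

Lemma lieb_qdE_row (k l s : int) (r : seq (K * int)) : 0 < l -> 0 < s ->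
  lieb (qdE q k l) (\sum_(p <- r) p.1 *: qdE q p.2 s) =
  \sum_(p <- r) (p.1 * qd_coef q k l p.2 s) *: qdE q (k + p.2) (l + s).
Proof.
move=> l0 s0; elim: r => [|p r IHr].
  by rewrite !big_nil; apply: qd_bracket0r.
by rewrite !big_cons lieb_linearr IHr lieb_qdE_pos // scalerA.
Qed.

Variables (t : nat) (M : set V).
Hypothesis t_gt0 : (0 < t)%N.
Hypothesis M_stable : forall (k l : int) w,
  t%:Z <= l -> M w -> M (lact (qdE q k l) w).

(** The element E_{k t, l t} is parallel to the first term E_{k,l}
    and to no other term of row [l], so the bracket with it removes exactly the
    first term; the factor [t] keeps the row index at least [t]. *)
Lemma annihilator_has_monomial (r : seq (K * int)) (l : int) :
  t%:Z <= l -> r != [::] -> uniq (unzip2 r) -> all (fun p => p.1 != 0) r ->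
  annihilates (\sum_(p <- r) p.1 *: qdE q p.2 l) M ->
  exists k n, t%:Z <= n /\ annihilates (qdE q k n) M.
Proof.
have [n] := ubnP (size r); elim: n r l => // n IHn [//|p [|p' r]] l.
  move=> _ tl _ _ /=; rewrite andbT big_seq1 => p0 /(annihilatesZ p0) h.
  by exists p.2, l.
move=> size_r tl _ /= /andP[pr uniq_r] /andP[p0 r0].
move=> /(annihilates_lieb (y := qdE q (p.2 * t%:Z) (l * t%:Z))).
have tlt : t%:Z <= l * t%:Z by nia.
move=> /(_ (fun w => @M_stable _ _ w tlt)); rewrite lieb_qdE_row; [|lia|lia].
rewrite big_cons {1}/qd_coef.
have -> : p.2 * (l * t%:Z) - l * (p.2 * t%:Z) = 0 by ring.
have -> : l * (p.2 * t%:Z) - p.2 * (l * t%:Z) = 0 by ring.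
rewrite subrr mulr0 scale0r add0r.
set c := fun x : K * int => x.1 * qd_coef q (p.2 * t%:Z) (l * t%:Z) x.2 l.
pose g x : K * int := (c x, p.2 * t%:Z + x.2).
move=> h; apply: (IHn [seq g x | x <- p' :: r] (l * t%:Z + l)) => //.
- by rewrite size_map.
- by lia.
- rewrite /unzip2 -map_comp.
  rewrite (map_comp (fun k => p.2 * t%:Z + k) snd) map_inj_uniq //.
  exact: addrI.
- rewrite all_map; apply/allP => x xr /=; rewrite /c mulf_neq0 //.
    exact: (allP (r0 : all _ (p' :: r)) x xr).
  rewrite /qd_coef -(opprB (x.2 * _)) exprz_subN_neq0 //.
  have -> : x.2 * (l * t%:Z) - l * (p.2 * t%:Z) = l * t%:Z * (x.2 - p.2) by ring.
  rewrite mulf_neq0 ?subr_eq0 //; first by nia.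
  by apply: contraNneq pr => <-; apply: (map_f snd xr).
- by rewrite big_map.
Qed.

(** The bracket with E_{m-k,n-l} moves E_{k,l} to E_{m,n}; off the line
    the two are not parallel, so the structure constant is invertible. *)
Lemma annihilator_off_line (k l m n : int) :
  t%:Z <= l -> l + t%:Z <= n -> k * n != l * m ->
  annihilates (qdE q k l) M -> annihilates (qdE q m n) M.
Proof.
move=> tl ln off; have tnl : t%:Z <= n - l by lia.
move=> /(annihilates_lieb (fun w => @M_stable (m - k) _ w tnl)).
rewrite lieb_qdE_pos ?subrK; [|lia|lia].
apply: annihilatesZ; rewrite /qd_coef -(opprB (k * _)) exprz_subN_neq0 //.
by apply: contra off => /eqP h; apply/eqP; lia.
Qed.

Lemma annihilator_tail (k l : int) :
  t%:Z <= l -> annihilates (qdE q k l) M ->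
  forall m n, l + 2 * t%:Z <= n -> annihilates (qdE q m n) M.
Proof.
move=> tl kl m n ln.
have [e|off] := eqVneq (k * n) (l * m); last first.
  by apply: annihilator_off_line kl => //; lia.
(* Row [l + t] has a point off the line through [(k, l)]: two distinct points
   of that row cannot both lie on it, as [l] is not 0. *)
have [r off] : exists r, k * (l + t%:Z) != l * r.
  have [e0|] := eqVneq (k * (l + t%:Z)) 0; last by exists 0; rewrite mulr0.
  by exists 1; rewrite e0; lia.
have hr : annihilates (qdE q r (l + t%:Z)) M by apply: annihilator_off_line kl.
apply: annihilator_off_line hr; [lia|lia|].
apply: contra off => /eqP e'; apply/eqP.
have n0 : n != 0 by lia.
apply: (mulIf n0).
have -> : k * (l + t%:Z) * n = (k * n) * (l + t%:Z) by ring.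
by rewrite e -!mulrA (mulrC m) -e'; ring.
Qed.

End Annihilator.

Theorem lemma5p2 (R : realType) (q : R[i]) (q_neq0 : q != 0)
  (q_not_root : forall n : nat, (0 < n)%N -> ~~ n.-unity_root q)
  (V : lieModType (qdiff q)) (V_in_O : categoryO V)
  (v : V) (v_neq0 : v != 0) :
  exists2 t : nat, (0 < t)%N &
    forall x : qdiff q, qdiff_ge q t x -> lact x v = 0.
Proof.
have [t t0 Vfin] := V_in_O.
have [s vs s_stable] := locally_finite_stable v Vfin.
have M_stable (k l : int) w : (t%:Z <= l)%R ->
    lspan [set` s]%classic w -> lspan [set` s]%classic (lact (qdE q k l) w).
  by move=> tl; apply/s_stable/sub_lspan; exists k => //; exists l.
have [N [a [[i0 a0] aE]]] :=
  stable_operators_dependent (T := fun k => lact (qdE q k%:Z t%:Z))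
    (fun k => lact_linearr (qdE q k%:Z t%:Z))
    (fun k u us => M_stable k%:Z t%:Z u (Order.POrderTheory.lexx _)
                     (sub_lspan (A := [set` s]%classic) us)).
pose J := [seq i <- index_enum 'I_N | a i != 0].
have [||||k [l [tl kl]]] := annihilator_has_monomial q_neq0 q_not_root t0 M_stable
    (r := [seq (a i, (i : nat)%:Z) | i <- J]) (Order.POrderTheory.lexx _).
- apply: contraTneq (_ : i0 \in J) => [|]; last by rewrite mem_filter a0 mem_index_enum.
  by move/(congr1 size)/eqP; rewrite size_map size_eq0 => /eqP ->.
- rewrite /unzip2 -map_comp map_inj_uniq ?filter_uniq ?index_enum_uniq //.
  by move=> i j /= [] /val_inj.
- by rewrite all_map; apply/allP => i; rewrite mem_filter => /andP[].
- move=> w Mw; rewrite (lact_suml _ fst (fun p => qdE q p.2 t%:Z)) big_map big_filter.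
  rewrite -[RHS](aE w Mw) [in RHS](bigID (fun i => a i != 0)) /=.
  rewrite [X in (_ + X)%R]big1 ?GRing.addr0 // => i; rewrite negbK => /eqP ->.
  exact: GRing.scale0r.
exists (absz (l + 2 * t%:Z)); first by lia.
apply: lspan_min => [|b x y xv yv|x [m _ [n /= ln <-]]].
- exact: lact0l.
- by rewrite lact_linearl xv yv GRing.scaler0 GRing.addr0.
- apply: (annihilator_tail q_neq0 q_not_root t0 M_stable tl kl); first by lia.
  exact: sub_lspan.
Qed.
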